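(* Let $S=\{p,q\}$ be a set of $m=2$ discrete probability distributions, and let $\mathcal G_S$ be the output of the greedy coupling algorithm on $S$. Then $$H(\mathcal G_S)\le H(\textsc{Profile}_S)+\frac{\log_2 e}{e}.$$
   Context: Distributions are finite vectors of nonnegative reals summing to $1$, with states sorted in non-increasing order. Greedy coupling algorithm: maintain the (remaining) masses of the states of each distribution in $S$. Repeatedly: let $r=\min_{p\in S}\max_j p(j)$ (minimum over distributions of their largest remaining state); if $r=0$ stop; otherwise append $r$ as the next state of $\mathcal G_S$ and subtract $r$ from the largest remaining state of every distribution in $S$ (ties broken arbitrarily). $\mathcal G_S$ is the resulting sequence of state masses (a probability distribution, and a valid coupling), with $H(\mathcal G_S)=\sum_t \mathcal G_S(t)\log_2(1/\mathcal G_S(t))$. For a distribution $p$, $\textsc{Sketch}_p:(0,1]\to\mathbb R$ is $\textsc{Sketch}_p(x)=p(i)$ for $x\in(\sum_{j>i}p(j),\sum_{j\ge i}p(j)]$; $\textsc{Profile}_S(x)=\min_{p\in S}\textsc{Sketch}_p(x)$; and $H(\textsc{Profile}_S)=\int_0^{1}\log_2(1/\textsc{Profile}_S(x))\,dx$. *)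

(* Defs.v *)
From HB Require Import structures.
From mathcomp Require Import all_boot all_order all_algebra.
From mathcomp Require Import all_classical all_reals all_analysis.
Set Implicit Arguments. Unset Strict Implicit. Unset Printing Implicit Defensive.
Import Order.TTheory GRing.Theory Num.Theory.
Local Open Scope ring_scope.

Section Defs.
Variable R : realType.

Definition is_dist (p : seq R) : Prop :=
  [/\ all (fun x => 0 <= x) p, \sum_(x <- p) x = 1 & sorted (fun x y => y <= x) p].

(* largest remaining state (masses are nonnegative, so 0 is a neutral start) *)
Definition maxs (s : seq R) : R := \big[Num.max/0]_(x <- s) x.

Definition minmax (ps : seq (seq R)) : R :=
  foldr (fun s acc => Num.min (maxs s) acc) (maxs (head [::] ps)) ps.

(* s' is obtained from s by subtracting r from one of its largest states
   (ties broken arbitrarily) *)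
Definition sub_largest (r : R) (s s' : seq R) : Prop :=
  exists2 i : nat, (i < size s)%N & s`_i = maxs s /\ s' = set_nth 0 s i (s`_i - r).

Inductive sub_all (r : R) : seq (seq R) -> seq (seq R) -> Prop :=
| sub_nil : sub_all r [::] [::]
| sub_cons s s' ps ps' : sub_largest r s s' -> sub_all r ps ps' ->
    sub_all r (s :: ps) (s' :: ps').

Inductive greedy_out : seq (seq R) -> seq R -> Prop :=
| greedy_stop ps : minmax ps = 0 -> greedy_out ps [::]
| greedy_step ps ps' g : minmax ps != 0 -> sub_all (minmax ps) ps ps' ->
    greedy_out ps' g -> greedy_out ps (minmax ps :: g).

Definition log2 (x : R) : R := ln x / ln 2.

Definition entropy (g : seq R) : R := \sum_(x <- g) x * log2 (1 / x).

Definition tailsum (p : seq R) (i : nat) : R := \sum_(y <- drop i p) y.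

Definition sketch (p : seq R) (x : R) : R :=
  \sum_(i < size p)
    (if (tailsum p i.+1 < x) && (x <= tailsum p i) then p`_i else 0).

Definition profile2 (p q : seq R) (x : R) : R := Num.min (sketch p x) (sketch q x).

Definition profile_entropy2 (p q : seq R) : \bar R :=
  (\int[@lebesgue_measure R]_(x in `]0%R, 1%R]%classic) (log2 (1 / profile2 p q x))%:E)%E.

End Defs.

(* Main.v *)
(* Let [T_p s] be the total mass of the states of [p] that are at most [s].  For
   [0 < x <= 1] one has [Profile x <= s] iff [x <= m s], where
   [m s = max (T_p s) (T_q s)], so that the entropy of the profile (in nats) is
   the integral of [m s / s] over [0 < s <= 1].  A greedy step of size [r]
   exhausts the largest state of one of the distributions and leaves a residual
   [d] of the largest state of the other.  It changes [m] into [m'] with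
   [m' s + r [r <= s] <= m s + d [d <= s < r]] for every [s]; integrating against
   [ds / s], the entropy [r ln (1/r)] of the step is paid by the decrease of the
   potential, up to [d ln (r/d) <= r / e].  The steps have total mass 1. *)
Require Import Defs.
From HB Require Import structures.
From mathcomp Require Import all_boot all_order all_algebra.
From mathcomp Require Import all_classical all_reals all_analysis.
From mathcomp Require Import measurable_realfun lra.
Import Order.TTheory GRing.Theory Num.Theory.
Local Open Scope ring_scope.
Set Implicit Arguments. Unset Strict Implicit. Unset Printing Implicit Defensive.

(** * Integration against [ds / s] over a finite grid *)

Section LogSum.
Variables (R : realType) (V : seq R).

(* Integral of [f s / s] over [0 < s <= 1] for functions [f] that are constant
   between consecutive points of the grid [V] and vanish below it. *)
Definition log_sum (f : R -> R) : R :=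
  \sum_(0 <= k < (size V).-1) f V`_k * (ln V`_k.+1 - ln V`_k).

Hypotheses (V_sorted : sorted <=%R V) (V1 : 1 \in V).
Hypothesis V01 : forall v, v \in V -> 0 < v <= 1.

Lemma grid_nth_le i j : (i <= j < size V)%N -> V`_i <= V`_j.
Proof.
move=> /andP[ij jV].
by apply: (sorted_leq_nth le_trans lexx _ V_sorted) => //; rewrite inE ?(leq_ltn_trans ij).
Qed.

Lemma grid_last : V`_(size V).-1 = 1.
Proof.
have iV : (index 1%R V < size V)%N by rewrite index_mem.
have sV : ((size V).-1 < size V)%N by rewrite ltn_predL (leq_ltn_trans _ iV).
apply: le_anti; have /V01/andP[_ ->] /= := mem_nth 0 sV.
by rewrite -[leLHS](nth_index 0 V1) grid_nth_le // sV andbT -ltnS prednK ?(leq_ltn_trans _ iV).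
Qed.

Lemma grid_step k : (k < (size V).-1)%N ->
  [/\ 0 < V`_k, 0 < V`_k.+1 & V`_k <= V`_k.+1].
Proof.
move=> kV; have k1V : (k.+1 < size V)%N by case: (size V) kV.
split; last by rewrite grid_nth_le // leqnSn.
- by have /V01/andP[] := mem_nth 0 (ltnW k1V).
- by have /V01/andP[] := mem_nth 0 k1V.
Qed.

Lemma log_sumD f g : log_sum (f \+ g) = log_sum f + log_sum g.
Proof. by rewrite -big_split; apply: eq_bigr => k _; rewrite /= mulrDl. Qed.

Lemma log_sumZ a f : log_sum (fun s : R => a * f s) = a * log_sum f.
Proof. by rewrite /log_sum mulr_sumr; apply: eq_bigr => k _; rewrite mulrA. Qed.

Lemma ler_log_sum f g : (forall s, 0 < s -> f s <= g s) -> log_sum f <= log_sum g.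
Proof.
move=> fg; apply: ler_sum_nat => k /andP[_ /grid_step[k0 k10 kk1]].
by rewrite ler_wpM2r ?fg // subr_ge0 ler_ln.
Qed.

(** The sum telescopes, and the grid ends at [1 >= d], where the logarithm vanishes. *)
Lemma sum_ln_max (d : R) : 0 < d <= 1 ->
  \sum_(0 <= k < (size V).-1) (ln (Num.max d V`_k.+1) - ln (Num.max d V`_k)) =
  - ln (Num.max d V`_0).
Proof.
move=> /andP[_ d1]; rewrite telescope_sumr // grid_last.
by rewrite (max_idPr d1) ln1 sub0r.
Qed.

(** Termwise comparison with the increments of [ln (max d s)]. A grid cell with [d] in its interior
    contributes 0 on the left, hence only an inequality. *)
Lemma log_sum_tail_le (d : R) : 0 < d <= 1 -> log_sum (fun s : R => (d <= s)%R%:R) <= - ln d.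
Proof.
move=> d01; have /andP[d0 _] := d01.
apply: (@le_trans _ _ (- ln (Num.max d V`_0))); last first.
  by rewrite lerN2 ler_ln ?posrE ?lt_max ?d0 // le_max lexx.
rewrite -sum_ln_max //; apply: ler_sum_nat => k /andP[_ /grid_step[k0 k10 kk1]].
case: (leP d V`_k) => dk /=.
  by rewrite mul1r (max_idPr (le_trans dk kk1)).
by rewrite mul0r subr_ge0 ler_ln ?posrE ?lt_max ?d0 // le_max lexx.
Qed.

(** No cell straddles a grid point, so the comparison with [ln (max a s)] is an equality in every
    term. *)
Lemma log_sum_tail a : a \in V -> log_sum (fun s : R => (a <= s)%R%:R) = - ln a.
Proof.
move=> aV; have a01 := V01 aV; have /andP[a0 _] := a01.
have aI : (index a V < size V)%N by rewrite index_mem.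
have aE : Num.max a V`_0 = a.
  by apply/max_idPl; rewrite -[leRHS](nth_index 0 aV) grid_nth_le.
rewrite -[in RHS]aE -sum_ln_max //; apply: eq_big_nat => k /andP[_ kV].
have [k0 k10 kk1] := grid_step kV.
case: (leP a V`_k) => ak /=.
  by rewrite mul1r (max_idPr (le_trans ak kk1)).
(* [V_k < a] puts [k] strictly before the index of [a], so the next grid point is still at most
   [a]. *)
have k1a : V`_k.+1 <= a.
  rewrite -[leRHS](nth_index 0 aV) grid_nth_le // aI andbT ltnNge.
  apply/negP => ik; move: ak; rewrite ltNge -[leLHS](nth_index 0 aV).
  by rewrite grid_nth_le // ik (leq_trans kV) // leq_pred.
by rewrite mul0r (max_idPl k1a) subrr.
Qed.

(** For [0 < d < r] the left side is at most [d ln (r / d)], whose maximum over [d] is [r / e]. *)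
Lemma log_sum_band (d r : R) : 0 <= d -> r \in V ->
  d * log_sum (fun s : R => ((d <= s)%R && (s < r)%R)%:R) <= r * expR (- 1).
Proof.
move=> d0 rV; have /andP[r0 r1] := V01 rV.
have er0 : 0 <= r * expR (- 1) by rewrite mulr_ge0 ?expR_ge0 // ltW.
move: d0; rewrite le_eqVlt => /predU1P[<-|d0]; first by rewrite mul0r.
case: (leP r d) => dr.
  have -> : log_sum (fun s : R => ((d <= s)%R && (s < r)%R)%:R) = 0.
    rewrite /log_sum big1_seq // => k _.
    case: (leP d V`_k) => dk /=; last by rewrite mul0r.
    by rewrite ltNge (le_trans dr dk) mul0r.
  by rewrite mulr0.
(* A band is a difference of two tails. The subtracted one is evaluated exactly, because [r] is a
   grid point. *)
have -> : (fun s : R => ((d <= s)%R && (s < r)%R)%:R) =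
    (fun s : R => (d <= s)%R%:R) \+ (fun s : R => - 1 * (r <= s)%R%:R) :> (R -> R).
  apply/funext => s /=; case: (leP r s) => rs.
    by rewrite (le_trans (ltW dr) rs) /=; lra.
  by rewrite andbT mulr0 addr0.
rewrite log_sumD log_sumZ (log_sum_tail rV) mulN1r opprK.
apply: (@le_trans _ _ (d * (ln r - ln d))).
  have := @log_sum_tail_le d; rewrite d0 (le_trans (ltW dr) r1) => /(_ isT) h.
  by rewrite ler_pM2l // addrC lerD2l.
have rd0 : 0 < r / d * expR (- 1) by rewrite mulr_gt0 ?expR_gt0 ?divr_gt0.
(* [ln y <= y - 1] at [y = r / (d e)] gives [ln (r / d) <= r / (d e)]. *)
have : ln (r / d * expR (- 1)) <= r / d * expR (- 1) - 1.
  by have := @le_ln1Dx R (r / d * expR (- 1) - 1); rewrite addrCA subrr addr0; apply; lra.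
rewrite lnM ?posrE ?expR_gt0 ?divr_gt0 // expRK ln_div // => h.
have -> : r * expR (- 1) = d * (r / d * expR (- 1)).
  by rewrite mulrA (mulrC d) divfK // gt_eqF.
by rewrite ler_pM2l //; lra.
Qed.

End LogSum.

(** * Mass of the states up to a threshold, and its change in one greedy step *)

Section MassLe.
Variable R : realType.
Implicit Types (p q s : seq R) (r t : R).

Definition mass_le s t : R := \sum_(y <- s | y <= t) y.

Definition profile_mass p q t : R := Num.max (mass_le p t) (mass_le q t).

Lemma maxs_cons a s : maxs (a :: s) = Num.max a (maxs s).
Proof. by rewrite /maxs big_cons. Qed.

Lemma maxs_ge0 s : 0 <= maxs s.
Proof.
by elim: s => [|a s IH]; rewrite ?maxs_cons ?le_max ?IH ?orbT // /maxs big_nil.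
Qed.

Lemma le_maxs s y : y \in s -> y <= maxs s.
Proof.
elim: s => // a s IH; rewrite inE maxs_cons le_max => /predU1P[->|/IH ->].
  by rewrite lexx.
by rewrite orbT.
Qed.

Lemma sum_ge0 s : all (>= 0) s -> 0 <= \sum_(y <- s) y.
Proof. by move=> /allP s0; rewrite big_seq sumr_ge0. Qed.

Lemma mem_le_sum s y : all (>= 0) s -> y \in s -> y <= \sum_(z <- s) z.
Proof.
move=> s0 ys; rewrite (big_rem y ys) /= lerDl big_seq sumr_ge0 // => z /mem_rem.
exact: (allP s0).
Qed.

Lemma mass_le_sum s t : all (>= 0) s -> mass_le s t <= \sum_(y <- s) y.
Proof.
move=> /allP s0; rewrite /mass_le big_mkcond /= !big_seq.
by apply: ler_sum => y /s0 y0; case: ifP.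
Qed.

Lemma mass_le_all s t : {in s, forall y, y <= t} -> mass_le s t = \sum_(y <- s) y.
Proof.
move=> st; rewrite /mass_le big_mkcond /= !big_seq.
by apply: eq_bigr => y /st ->.
Qed.

Lemma mass_le_cons a s t : mass_le (a :: s) t = (a <= t)%R%:R * a + mass_le s t.
Proof.
by rewrite /mass_le big_cons; case: ifP; rewrite ?mul1r // mul0r add0r.
Qed.

Lemma mass_le_cat s1 s2 t : mass_le (s1 ++ s2) t = mass_le s1 t + mass_le s2 t.
Proof. exact: big_cat. Qed.

Lemma sub_largest_cat r s s' : sub_largest r s s' ->
  exists s1 s2, s = s1 ++ maxs s :: s2 /\ s' = s1 ++ (maxs s - r) :: s2.
Proof.
move=> [i ilt [si ->]]; exists (take i s), (drop i.+1 s).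
by rewrite -si -drop_nth // cat_take_drop set_nthE ilt.
Qed.

Section SubLargest.
Variables (r : R) (s s' : seq R).
Hypotheses (s0 : all (>= 0) s) (ss' : sub_largest r s s').

Lemma sub_largest_ge0 : r <= maxs s -> all (>= 0) s'.
Proof.
have [s1 [s2 [es ->]]] := sub_largest_cat ss' => rs.
by move: s0; rewrite {1}es !all_cat /= subr_ge0 rs => /and3P[-> _ ->].
Qed.

Lemma sub_largest_sum : \sum_(y <- s') y = \sum_(y <- s) y - r.
Proof.
have [s1 [s2 [es ->]]] := sub_largest_cat ss'.
by rewrite [in RHS]es !big_cat !big_cons /=; lra.
Qed.

(** Below [maxs s] the old largest state is not counted, so only its residual can add mass. *)
Lemma sub_largest_mass_le t : t < maxs s ->
  mass_le s' t = mass_le s t + (maxs s - r <= t)%R%:R * (maxs s - r).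
Proof.
have [s1 [s2 [es ->]]] := sub_largest_cat ss' => ts.
have -> : mass_le s t = mass_le s1 t + mass_le s2 t.
  by rewrite [in LHS]es mass_le_cat mass_le_cons leNgt ts mul0r add0r.
by rewrite mass_le_cat mass_le_cons addrA addrAC.
Qed.

End SubLargest.

Section GreedyStep.
Variables (M r : R) (p q p' q' : seq R).
Hypotheses (p0 : all (>= 0) p) (q0 : all (>= 0) q).
Hypotheses (pM : \sum_(y <- p) y = M) (qM : \sum_(y <- q) y = M).
Hypotheses (pp' : sub_largest r p p') (qq' : sub_largest r q q').
Hypothesis rE : r = Num.min (maxs p) (maxs q).
Let d := Num.max (maxs p) (maxs q) - r.

Lemma greedy_step_mass t :
  profile_mass p' q' t + r * (r <= t)%R%:R <=
  profile_mass p q t + d * ((d <= t)%R && (t < r)%R)%:R.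
Proof.
have [rp rq] : r <= maxs p /\ r <= maxs q by rewrite rE !ge_min !lexx orbT.
case: (leP r t) => rt; rewrite ?andbF ?andbT ?mulr1 ?mulr0 addr0.
  (* For [r <= t] the distribution with the smaller maximum has all its states at most [t], so the
     old profile mass is at least [M], while the new totals are [M - r]. *)
  apply: (@le_trans _ _ M).
    rewrite -lerBrDr /profile_mass ge_max -{1}pM -qM.
    rewrite -(sub_largest_sum pp') -(sub_largest_sum qq').
    rewrite !mass_le_sum ?(sub_largest_ge0 q0 qq') //.
    exact: (sub_largest_ge0 p0 pp').
  have allt s : maxs s <= r -> {in s, forall y, y <= t}.
    by move=> sr y /le_maxs ys; rewrite (le_trans ys) ?(le_trans sr).
  rewrite /profile_mass le_max; case: (leP (maxs p) (maxs q)) => pq.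
    by rewrite (mass_le_all (allt p _)) ?pM ?lexx // rE (min_idPl pq).
  by rewrite orbC (mass_le_all (allt q _)) ?qM ?lexx // rE (min_idPr (ltW pq)).
(* For [t < r] neither largest state was counted; of the two residuals one is 0 and the other is
   [d]. *)
rewrite /profile_mass (sub_largest_mass_le pp') ?(lt_le_trans rt) //.
rewrite (sub_largest_mass_le qq') ?(lt_le_trans rt) //.
have h e : e = 0 \/ e = d -> (e <= t)%R%:R * e <= d * (d <= t)%R%:R.
  case=> ->; rewrite ?mulr0 1?mulrC // mulr_ge0 // subr_ge0.
  by rewrite le_max rp.
rewrite ge_max; apply/andP; split; apply: lerD; rewrite ?le_max ?lexx ?orbT //; apply: h.
  by rewrite /d rE; case: (leP (maxs p) (maxs q)) => _; [left; rewrite subrr|right].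
by rewrite /d rE; case: (leP (maxs p) (maxs q)) => _; [right|left; rewrite subrr].
Qed.

End GreedyStep.

End MassLe.

Lemma mass_le_ge0 (R : realType) (s : seq R) (t : R) :
  all (>= 0) s -> 0 <= mass_le s t.
Proof. by move=> /allP s0; rewrite /mass_le big_seq_cond sumr_ge0 // => y /andP[/s0]. Qed.

(** * Induction along the greedy run *)

Section GreedyEntropy.
Variables (R : realType) (V : seq R).
Hypotheses (V_sorted : sorted <=%R V) (V1 : 1 \in V).
Hypothesis V01 : forall v, v \in V -> 0 < v <= 1.

Lemma log_sum_ge0 (f : R -> R) : (forall s, 0 < s -> 0 <= f s) -> 0 <= log_sum V f.
Proof.
move=> f0; rewrite /log_sum big_seq sumr_ge0 // => k; rewrite mem_index_iota => /= kV.
have [k0 k10 kk1] := grid_step V_sorted V01 kV.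
by rewrite mulr_ge0 ?f0 // subr_ge0 ler_ln.
Qed.

Lemma minmax2 (p q : seq R) : minmax [:: p; q] = Num.min (maxs p) (maxs q).
Proof. by rewrite /minmax /= minCA minxx minC. Qed.

(** The remaining mass [M] is general so that a step of size [r] spends [r / e] of the budget
    [M / e]. The grid is fixed for the whole run; a residual falling between its points is covered
    by the one-sided [log_sum_tail_le]. *)
Lemma greedy_entropy_le (M : R) (p q G : seq R) :
  greedy_out [:: p; q] G -> M <= 1 ->
  all (>= 0) p -> all (>= 0) q ->
  \sum_(y <- p) y = M -> \sum_(y <- q) y = M ->
  (forall v, v \in G -> 0 < v <= 1 -> v \in V) ->
  \sum_(v <- G) v * - ln v <= log_sum V (profile_mass p q) + M * expR (- 1).
Proof.
move e : [:: p; q] => ps H.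
elim: H M p q e => {ps G} [ps _ | ps ps' G r0 sub _ IH] M p q e; subst ps => M1 p0 q0 pM qM GV.
  rewrite big_nil addr_ge0 ?mulr_ge0 ?expR_ge0 // -?pM ?sum_ge0 // log_sum_ge0 // => s _.
  by rewrite le_max mass_le_ge0.
move: r0 sub GV; set r := minmax _ => r0 sub GV.
have rE : r = Num.min (maxs p) (maxs q) by rewrite /r minmax2.
inversion sub as [|p1 p' ps1 ps1' pp' sub1]; subst.
inversion sub1 as [|q1 q' ps2 ps2' qq' sub2]; subst.
inversion sub2; subst.
have {}r0 : 0 < r by rewrite lt_neqAle eq_sym r0 rE le_min !maxs_ge0.
have [rp rq] : r <= maxs p /\ r <= maxs q by rewrite rE !ge_min !lexx orbT.
(* A step never exceeds the remaining mass, so [r <= 1] and the output mass [r] is a grid point. *)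
have rM : r <= \sum_(y <- p) y.
  apply: le_trans rp (mem_le_sum p0 _).
  have [s1 [s2 [pE _]]] := sub_largest_cat pp'.
  by rewrite [X in _ \in X]pE mem_cat inE eqxx orbT.
have rV : r \in V by apply: GV; rewrite ?mem_head // r0 (le_trans rM).
have := IH (\sum_(y <- p) y - r) p' q' erefl.
rewrite (sub_largest_sum pp') (sub_largest_sum qq') qM.
rewrite (sub_largest_ge0 p0 pp' rp) (sub_largest_ge0 q0 qq' rq).
move=> /(_ _ isT isT erefl erefl) h.
have {}h : \sum_(v <- G) v * - ln v <= log_sum V (profile_mass p' q') +
    (\sum_(y <- p) y - r) * expR (- 1).
  apply: h; first by rewrite lerBlDr (le_trans M1) // lerDl ltW.
  by move=> v vG; apply: GV; rewrite inE vG orbT.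
(* The pointwise step inequality is integrated; the tail from [r] gives [- ln r], and the band costs
   at most [r / e]. *)
have := ler_log_sum V_sorted V01
  (fun t _ => greedy_step_mass p0 q0 erefl qM pp' qq' rE t).
rewrite (log_sumD V (profile_mass p' q')) (log_sumD V (profile_mass p q)) !log_sumZ.
rewrite (log_sum_tail V_sorted V1 V01 rV) big_cons.
have := @log_sum_band _ _ V_sorted V1 V01 (Num.max (maxs p) (maxs q) - r) r _ rV.
rewrite subr_ge0 le_max rp => /(_ isT).
lra.
Qed.

End GreedyEntropy.

(** * The sketch, and the profile entropy as a grid sum *)

Section Sketch.
Variable R : realType.
Implicit Types (p q : seq R) (x t : R).

Lemma sketch_cons a p x : sketch (a :: p) x =
  (if (\sum_(y <- p) y < x) && (x <= a + \sum_(y <- p) y) then a else 0) +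
  sketch p x.
Proof. by rewrite /sketch big_ord_recl /tailsum /= drop0 big_cons. Qed.

Lemma sketch_gt_sum p x : all (>= 0) p -> \sum_(y <- p) y < x -> sketch p x = 0.
Proof.
elim: p => [|a p IH] /=; first by rewrite /sketch big_ord0.
move=> /andP[a0 p0]; rewrite big_cons sketch_cons => xa.
rewrite IH // ?(le_lt_trans _ xa) ?lerDr // addr0.
by rewrite (leNgt x) xa andbF.
Qed.

(** The sketch is the generalized inverse of [mass_le p]. In the induction the head, being the
    largest state, occupies the topmost interval. *)
Lemma sketchP p x : all (>= 0) p -> sorted (fun x y => y <= x) p ->
  0 < x <= \sum_(y <- p) y ->
  [/\ sketch p x \in p, 0 < sketch p x &
      forall t, (sketch p x <= t) = (x <= mass_le p t)].
Proof.
elim: p => [|a p IH] /=; first by rewrite big_nil => _ _ /andP[/lt_le_trans/[apply]]; rewrite ltxx.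
move=> /andP[a0 p0] ap; rewrite big_cons sketch_cons => /andP[x0 xa].
have pa : {in p, forall y, y <= a}.
  apply/allP; apply: (order_path_min _ ap) => u v w vu uw; exact: le_trans uw vu.
have ptot t : a <= t -> mass_le p t = \sum_(y <- p) y.
  by move=> at'; rewrite mass_le_all // => y /pa/le_trans; apply.
case: (ltP (\sum_(y <- p) y) x) => px /=.
  rewrite xa sketch_gt_sum // addr0; split; first exact: mem_head.
    (* A head [a <= 0] would have an empty interval. *)
    by rewrite ltNge; apply/negP => a_le0; move: xa; rewrite leNgt (le_lt_trans _ px) // gerDr.
  move=> t; rewrite mass_le_cons; case: (leP a t) => at'.
    by rewrite mul1r ptot // xa.
  by rewrite mul0r add0r leNgt (le_lt_trans (mass_le_sum _ p0) px).
have [|sp s0 st] := IH p0 (path_sorted ap); first by rewrite x0.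
rewrite add0r; split => // [|t]; first by rewrite inE sp orbT.
rewrite mass_le_cons st; case: (leP a t) => at'; last by rewrite mul0r add0r.
by rewrite mul1r ptot // px (le_trans px) // lerDr.
Qed.

Section ProfileEntropy.
Variables (V p q : seq R).
Hypotheses (V_sorted : sorted <=%R V) (V1 : 1 \in V).
Hypothesis V01 : forall v, v \in V -> 0 < v <= 1.
Hypotheses (p_dist : is_dist p) (q_dist : is_dist q).
Hypothesis pqV : forall v, v \in p ++ q -> 0 < v <= 1 -> v \in V.

(** The profile value is a grid point, so [- ln] of it is the tail sum from it; [sketchP] rewrites
    the tail condition in terms of [x]. *)
Lemma ln_profile2 x : 0 < x <= 1 ->
  0 < profile2 p q x /\
  - ln (profile2 p q x) = log_sum V (fun s => (x <= profile_mass p q s)%R%:R).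
Proof.
case: p_dist q_dist => p0 p1 psort [q0 q1 qsort] x01.
have [|sp sp0 spt] := sketchP p0 psort (x := x); first by rewrite p1.
have [|sq sq0 sqt] := sketchP q0 qsort (x := x); first by rewrite q1.
have pr0 : 0 < profile2 p q x by rewrite lt_min sp0.
split => //; rewrite -(log_sum_tail V_sorted V1 V01).
  by apply: eq_bigr => k _; rewrite ge_min le_max spt sqt.
apply: pqV; first by rewrite mem_cat /profile2; case: leP => _; rewrite ?sp ?sq ?orbT.
by rewrite pr0 ge_min -{1}p1 mem_le_sum.
Qed.

(** Layer-cake argument: the integral over [x] is exchanged with the grid sum, and the indicator of
    []0, m k]] integrates to [m k]. *)
Lemma profile_entropy2E :
  profile_entropy2 p q = (log_sum V (profile_mass p q) / ln 2)%:E.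
Proof.
case: p_dist q_dist => p0 p1 _ [q0 q1 _].
have ln2 : 0 < ln 2 :> R by rewrite ln_gt0 // ltr1n.
pose c k : R := (ln V`_k.+1 - ln V`_k) / ln 2.
pose n := (size V).-1.
pose m k := profile_mass p q V`_k.
have c0 k : (k < n)%N -> 0 <= c k.
  move=> /(grid_step V_sorted V01)[k0 k10 kk1].
  by rewrite divr_ge0 ?(ltW ln2) // subr_ge0 ler_ln.
have m01 k : 0 <= m k <= 1.
  rewrite /m /profile_mass le_max mass_le_ge0 //= ge_max -{1}p1 -q1.
  by rewrite !mass_le_sum.
rewrite /profile_entropy2.
transitivity (\int[@lebesgue_measure R]_(x in `]0%R, 1%R]%classic)
    \sum_(k < n) ((c k)%:E * (\1_(`]0%R, m k]%classic) x)%:E))%E.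
  apply: eq_integral => x; rewrite inE /= in_itv /= => x01.
  have [pr0 prE] := ln_profile2 x01.
  rewrite /log2 div1r lnV ?posrE // prE /log_sum big_mkord mulr_suml -sumEFin.
  apply: eq_bigr => k _; rewrite -EFinM indicE mem_setE in_itv /=.
  by have /andP[-> _] := x01; rewrite -mulrA mulrC.
rewrite ge0_integral_sum //; last 2 first.
- move=> k; apply: measurable_funeM.
  by apply/measurable_EFinP; exact: measurable_indic.
- by move=> k x _; rewrite -EFinM lee_fin mulr_ge0 ?c0.
rewrite /log_sum big_mkord mulr_suml -sumEFin; apply: eq_bigr => k _.
rewrite ge0_integralZl_EFin ?c0 //; last first.
  by apply/measurable_EFinP; exact: measurable_indic.
rewrite integral_indic // setIidl; last first.
  move=> x /=; rewrite !in_itv /= => /andP[-> xm] /=.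
  by rewrite (le_trans xm) //; have /andP[] := m01 k.
rewrite [X in (_ * X)%E](lebesgue_measure_itv `]0%R, m k]) /= lte_fin -EFinB subr0.
have /andP[m0 _] := m01 k.
have -> : (if (0 < m k)%R then (m k)%:E else 0)%E = (m k)%:E.
  by case: ltP => // mk; congr EFin; apply/le_anti; rewrite m0 mk.
by rewrite -EFinM /c mulrC mulrA.
Qed.

End ProfileEntropy.
End Sketch.

(** * Choice of the grid and passage to base 2 *)

Theorem theorem2 (R : realType) (p q : seq R) (G : seq R) :
  is_dist p -> is_dist q -> greedy_out [:: p; q] G ->
  ((entropy G)%:E <= profile_entropy2 p q + (log2 (expR 1) / expR 1)%:E)%E.
Proof.
move=> p_dist q_dist pqG.
have ln2 : 0 < ln 2 :> R by rewrite ln_gt0 // ltr1n.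
(* The grid collects the positive masses of inputs and output; the point 1 closes it on the
   right. *)
pose V : seq R := sort <=%R (1 :: [seq v <- p ++ q ++ G | 0 < v <= 1]).
have memV v : v \in V = (v == 1) || (0 < v <= 1) && (v \in p ++ q ++ G).
  by rewrite mem_sort inE mem_filter.
have V_sorted : sorted <=%R V by exact: sort_le_sorted.
have V1 : 1 \in V by rewrite memV eqxx.
have V01 v : v \in V -> 0 < v <= 1.
  by rewrite memV => /predU1P[->|/andP[]//]; rewrite ltr01 lexx.
rewrite (@profile_entropy2E _ V) //; last first.
  by move=> v vpq v01; rewrite memV v01 catA mem_cat vpq orbT.
case: p_dist q_dist => p0 p1 _ [q0 q1 _].
have GV v : v \in G -> 0 < v <= 1 -> v \in V.
  by move=> vG v01; rewrite memV v01 !mem_cat vG !orbT.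
have := greedy_entropy_le V_sorted V1 V01 pqG (lexx 1) p0 q0 p1 q1 GV.
(* [ln] is 0 on nonpositive reals, so the terms agree for [v <= 0] too. *)
have -> : entropy G = (\sum_(v <- G) v * - ln v) / ln 2.
  rewrite /entropy mulr_suml; apply: eq_bigr => v _; rewrite -mulrA; congr (_ * _).
  rewrite /log2 div1r; case: (ltP 0 v) => v0; first by rewrite lnV.
  by rewrite (ln0 v0) ln0 ?invr_le0 // oppr0.
rewrite -EFinD lee_fin /log2 expRK mul1r -expRN => h.
by rewrite ler_pdivrMr // mulrDl divfK ?gt_eqF // mulrAC mulVf ?gt_eqF.
Qed.
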